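(* Let $Z$ be a random element of $\mathcal V_\infty$, let $\alpha\in(0,1)$ not depend on $N$, and let $(g_A)$, indexed by the finite subsets $A$ of $\{1,2,\dots\}$ (including $\emptyset$), be i.i.d. $N(0,1)$ random variables. For $x\in\mathcal V_\infty$ let $x_N\in\mathcal V_N$ denote the first $N$ entries of $x$, and define $$g_{x_N}=2^{-N/2}\Big\{g_\emptyset+\sum_{A\subseteq[N],\,A\ne\emptyset}\frac{1}{\sqrt{1+\frac{\alpha}{1-\alpha}(1-\rho_A)}}\prod_{k\in A}(-1)^{x[k]}\,g_A\Big\}.$$ Let $\mathcal G_N=(g_{x_N})_{x_N\in\mathcal V_N}$ for $N\ge1$ and $\mathcal G_0=(g_\emptyset)$. Then for any given $x\in\mathcal V_\infty$ the Gaussian sequence $(g_{x_N})_{N\in\mathbb N}$ is a Markov chain, and $(\mathcal G_N)_{N\in\mathbb N}$ is a Markov chain. Moreover, for $N\ge1$ and $x_N,y_N\in\mathcal V_N$ (with $x_{N-1}$ the first $N-1$ entries of $x_N$), $$\mathbb E\big[g_{x_N}\mid\mathcal G_{N-1}\big]=2^{-1/2}g_{x_{N-1}},$$ $$\mathrm{Cov}\big(g_{x_N},g_{y_N}\mid\mathcal G_{N-1}\big)=\frac1{2^N}\sum_{A\subseteq[N],\,A\supseteq\{N\}}\frac{1}{1+\frac{\alpha}{1-\alpha}(1-\rho_A)}\prod_{k\in A}(-1)^{x[k]+y[k]}.$$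
   Context: $[N]=\{1,\dots,N\}$, $\mathcal V_N=\{0,1\}^N$, $\mathcal V_\infty=\{0,1\}^\infty$ (sequences indexed by $1,2,\dots$), $\mathbb N=\{0,1,2,\dots\}$, and $x[k]$ is the $k$-th entry of $x$. For finite $A\subset\{1,2,\dots\}$, $\rho_A=\mathbb E\big[\prod_{j\in A}(-1)^{Z[j]}\big]$, $\rho_\emptyset=1$. For each $N$, $\mathcal G_N$ is a zero mean Gaussian field on $\mathcal V_N$ with covariance $(1-\alpha)\sum_{t\ge0}\alpha^t\mathbb P(X_t=y\mid X_0=x)$, where $(X_t)$ is the random walk on $\mathcal V_N$ with $X_{t+1}=X_t+Z_t\bmod 2$ and the $Z_t$ are i.i.d. copies of the first $N$ entries of $Z$, with $Z_t$ independent of $(X_\tau)_{\tau\le t}$. When $N=0$, $x_0$ is the empty word and $g_{x_0}=g_\emptyset$. *)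

(* Defs.v *)
From HB Require Import structures.
From mathcomp Require Import all_boot all_order all_algebra finmap.
From mathcomp Require Import all_classical all_reals all_analysis.

Set Implicit Arguments.
Unset Strict Implicit.
Unset Printing Implicit Defensive.

Import Order.TTheory GRing.Theory Num.Theory.

Local Open Scope classical_set_scope.
Local Open Scope ring_scope.

(* T^I with its product sigma-algebra. *)
Definition cylinders (I : Type) d (T : measurableType d) : set (set (I -> T)) :=
  [set C | exists i (B : set T), measurable B /\ C = (fun f => f i) @^-1` B].

Notation product_space I T := (g_sigma_algebraType (@cylinders I _ T)).

Section probability_notions.
Context d (O : measurableType d) (R : realType) (P : probability O R).

Definition independent (I : choiceType) (X : I -> {RV P >-> R}) :=
  forall (J : {fset I}) (B : I -> set R), (forall i, measurable (B i)) ->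
    P (\bigcap_(i in [set` J]) X i @^-1` B i) =
    (\prod_(i <- J) P (X i @^-1` B i))%E.

Definition iid_standard_normal (I : choiceType) (X : I -> {RV P >-> R}) :=
  (forall i (B : set R), measurable B ->
     distribution P (X i) B = normal_prob 0 1 B) /\
  independent X.

(* Constants count as Gaussian; they need a separate clause because
   normal_prob m 0 is not the Dirac mass at m. *)
Definition gaussian (X : O -> R) :=
  measurable_fun setT X /\
  exists m s : R, forall B, measurable B ->
    pushforward P X B = if s == 0 then \d_m B else normal_prob m s B.

Definition gaussian_sequence (X : nat -> O -> R) :=
  forall (n : nat) (c : 'I_n -> R), gaussian (fun w => \sum_(i < n) c i * X i w).

(* Y is a version of E[X | F], for F a sub-sigma-algebra. *)
Definition is_cond_exp (F : set (set O)) (X Y : O -> R) :=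
  [/\ P.-integrable setT (EFin \o X),
      P.-integrable setT (EFin \o Y),
      forall B : set R, measurable B -> F (Y @^-1` B) &
      forall A, F A -> (\int[P]_(w in A) (Y w)%:E = \int[P]_(w in A) (X w)%:E)%E].

(* C is a version of Cov(X, Y | F) = E[(X - E[X | F]) (Y - E[Y | F]) | F]. *)
Definition is_cond_cov (F : set (set O)) (X Y C : O -> R) :=
  exists mX mY : O -> R,
    [/\ is_cond_exp F X mX, is_cond_exp F Y mY &
        is_cond_exp F (fun w => (X w - mX w) * (Y w - mY w)) C].

Definition sigma_past (ds : nat -> measure_display)
    (S : forall n, measurableType (ds n)) (X : forall n, O -> S n) (n : nat) :
    set (set O) :=
  <<s \bigcup_(k in [set k | (k <= n)%N]) g_sigma_algebra_preimage (X k) >>.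

(* P(X_{n+1} \in B | X_0, ..., X_n) = P(X_{n+1} \in B | X_n) almost surely,
   the state space being allowed to vary with n: some version of the
   right-hand side is a version of the left-hand side. *)
Definition markov_chain (ds : nat -> measure_display)
    (S : forall n, measurableType (ds n)) (X : forall n, O -> S n) :=
  (forall n, measurable_fun setT (X n)) /\
  forall n (B : set (S n.+1)), measurable B ->
    exists h : O -> R,
      is_cond_exp (g_sigma_algebra_preimage (X n)) \1_(X n.+1 @^-1` B) h /\
      is_cond_exp (sigma_past X n) \1_(X n.+1 @^-1` B) h.

End probability_notions.

(* Positions are counted from 0: position k of a sequence (or element k of a
   finite set) stands for the mathematical position k + 1, so that finite
   subsets of {1, 2, ...} are {fset nat} and [N] = {1, ..., N} is {0, ..., N-1}. *)
Definition segment (N : nat) : {fset nat} := [fset k in iota 0 N]%fset.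

Definition trunc (N : nat) (x : nat -> bool) : N.-tuple bool :=
  [tuple x i | i < N].

(* x_{N-1} for x_N with N.+1 entries *)
Definition trunc_last (N : nat) (x : N.+1.-tuple bool) : N.-tuple bool :=
  trunc N (nth false x).

Section field.
Context (R : realType) dZ (OZ : measurableType dZ) (PZ : probability OZ R)
  (Z : {RV PZ >-> product_space nat bool}).

Definition rho (A : {fset nat}) : R :=
  fine 'E_PZ[fun w => \prod_(j <- A) (-1) ^+ (Z w j)].

Definition weight (alpha : R) (A : {fset nat}) : R :=
  1 + alpha / (1 - alpha) * (1 - rho A).

Context d (O : measurableType d) (P : probability O R)
  (g : {fset nat} -> {RV P >-> R}) (alpha : R).

(* For N = 0 the sum is empty and this is g_emptyset. *)
Definition gfield (N : nat) (x : N.-tuple bool) (w : O) : R :=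
  2 `^ (- (N%:R / 2)) *
  (g fset0 w +
   \sum_(A <- fpowerset (segment N) | A != fset0)
     (Num.sqrt (weight alpha A))^-1 *
     (\prod_(k <- A) (-1) ^+ (nth false x k)) * g A w).

Definition Gfield (N : nat) (w : O) : product_space (N.-tuple bool) R :=
  fun x => gfield x w.

End field.

Arguments Gfield {R dZ OZ PZ} Z {d O P} g alpha N w.

(* Main.v *)
Require Import Defs.
From HB Require Import structures.
From mathcomp Require Import all_boot all_order all_algebra finmap.
From mathcomp Require Import all_classical all_reals all_analysis.
From mathcomp Require Import measurable_realfun ring lra.

Set Implicit Arguments.
Unset Strict Implicit.
Unset Printing Implicit Defensive.

Import Order.TTheory GRing.Theory Num.Theory.
Import numFieldNormedType.Exports.

Local Open Scope classical_set_scope.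
Local Open Scope ring_scope.

(** Write [N] for the set of the first N positions.  The sets A contained in
    [N + 1] are those contained in [N] and those containing the position N + 1,
    and for the former neither the character of A at x nor the weight of A
    depends on N.  Splitting the defining sum accordingly gives, with c equal
    to 2 to the power -1/2, the recursion

      g_{x_{N+1}} = c * g_{x_N} + xi_x

    in which xi_x, the innovation, is a linear combination of the g_A with
    N + 1 in A ([gfieldS]).  The fields of index at most N only involve the g_A
    with A contained in [N], so the whole family (xi_x)_x is independent of
    them.  All four claims follow from this decomposition.

    - Markov property: a process with X_{n+1} = phi (X_n, V_n), V_n independent
      of the past, is a Markov chain ([markov_chain_innovation]).  Freezing X_n
      ([cond_exp_freezing]) gives the conditional law of X_{n+1} as a function
      of X_n, and this function does not see whether one conditions on X_n or
      on the past.  It applies to a single path, with V_n the innovation along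
      that path, and to the entire field, with V_n the family of all
      innovations.
    - Conditional mean: the first term of the recursion is a function of the
      field of index N, and the innovation is independent of it and centred
      ([cond_exp_add_indep]).
    - Conditional covariance: the centred variables are exactly xi_x and xi_y,
      whose product is independent of the past, so the conditional covariance
      is the constant E [xi_x * xi_y] ([cond_exp_indep]), computed from the
      orthonormality of the g_A.
    - Gaussianity: linear combinations of the coordinates of a path are linear
      combinations of finitely many g_A.

    Independence of sigma-algebras generated by disjoint subfamilies of the g_A
    comes from the product formula on finite cylinders by the pi-lambda theorem
    ([indep_sigma_family]).  Every fact about moments and laws is drawn from
    one statement: a linear combination of i.i.d. standard normal variables
    with coefficients c_i has the law of sigma * G, where G is standard normal
    and sigma^2 is the sum of the c_i^2 ([lincomb_law]).  It is proved by adding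
    one variable at a time, through the convolution of two normal densities
    ([normal_prob_convolution]).  Centredness follows from the invariance of
    sigma under c |-> -c, and covariances follow from second moments by
    polarization. *)

(** * Integration against densities and image measures *)

Section density.
Context d (T : measurableType d) (R : realType).
Local Open Scope ereal_scope.
Variables (mu nu : {measure set T -> \bar R}) (p : T -> R).
Hypothesis mp : measurable_fun setT p.
Hypothesis p0 : forall x, (0 <= p x)%R.
Hypothesis nuE : forall A, measurable A -> nu A = \int[mu]_(x in A) (p x)%:E.

Import HBNNSimple.

(** Exact for indicators by hypothesis, then for simple functions by linearity,
    then for all nonnegative functions by monotone convergence. *)
Lemma ge0_integral_density (f : T -> \bar R) :
  measurable_fun setT f -> (forall x, 0 <= f x) ->
  \int[nu]_x f x = \int[mu]_x (f x * (p x)%:E).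
Proof.
move=> mf f0; pose g := nnsfun_approx measurableT mf.
have gf x : (EFin \o g ^~ x) @ \oo --> f x.
  by apply: cvg_nnsfun_approx => // ? _; exact: f0.
transitivity (limn (fun n => \int[nu]_x (g n x)%:E)).
  rewrite -monotone_convergence//=.
  - by apply: eq_integral => x _; apply/esym/cvg_lim => //; exact: gf.
  - by move=> n; exact/measurable_EFinP.
  - by move=> n x _; rewrite lee_fin.
  - by move=> x _ m n mn; rewrite lee_fin; exact/lefP/nd_nnsfun_approx.
transitivity (limn (fun n => \int[mu]_x ((g n x)%:E * (p x)%:E))); last first.
  rewrite -monotone_convergence//=.
  - apply: eq_integral => x _; apply/cvg_lim => //.
    by apply: cvgeZr => //; exact: gf.
  - by move=> n; apply: emeasurable_funM; exact/measurable_EFinP.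
  - by move=> n x _; rewrite mule_ge0 ?lee_fin.
  - move=> x _ m n mn; rewrite lee_wpmul2r ?lee_fin//.
    exact/lefP/nd_nnsfun_approx.
congr (limn _); apply/funext => n.
under eq_integral do rewrite fimfunE -fsumEFin//.
rewrite ge0_integral_fsum//; last 2 first.
  - by move=> y; exact/measurable_EFinP/measurable_funM.
  - by move=> y x _; rewrite nnfun_muleindic_ge0.
transitivity (\int[mu]_x (\sum_(y \in range (g n))
    (y * \1_(g n @^-1` [set y]) x)%:E * (p x)%:E)); last first.
  apply: eq_integral => x _; rewrite [in RHS]fimfunE -fsumEFin//.
  rewrite ge0_mule_fsuml//.
  by move=> y; rewrite nnfun_muleindic_ge0.
rewrite [RHS]ge0_integral_fsum//; last 2 first.
  - by move=> y; apply: emeasurable_funM; apply/measurable_EFinP => //;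
      exact: measurable_funM.
  - by move=> y x _; rewrite mule_ge0 ?nnfun_muleindic_ge0 ?lee_fin.
(* Both sides are now sums over the values r of the simple function. *)
apply: eq_fsbigr => r rg.
have r0 : (0 <= r)%R by move: rg; rewrite inE => -[x _ <-].
under [RHS]eq_integral do rewrite EFinM -muleA.
rewrite integralZl_indic_nnsfun// integral_indic// setIT.
rewrite ge0_integralZl//=; last 2 first.
  - by apply: emeasurable_funM; exact/measurable_EFinP.
  - by move=> x _; rewrite mule_ge0 ?lee_fin.
rewrite nuE// [in LHS]integral_mkcond; congr (_ * _).
apply: eq_integral => x _; rewrite patchE indicE.
by case: ifPn => _; rewrite ?mul1e ?mul0e.
Qed.

End density.

Section image_measure.
Context d1 d2 (S : measurableType d1) (T : measurableType d2) (R : realType).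
Implicit Type f : S -> T.

(** The measurability proof is an argument so that the measure structure of the
    image can be inferred from the term. *)
Definition image_measure (mu : {measure set S -> \bar R}) f
  (mf : measurable_fun setT f) : set T -> \bar R := pushforward mu f.

Section measure.
Variables (mu : {measure set S -> \bar R}) (f : S -> T).
Hypothesis mf : measurable_fun setT f.

Let m : {measure set T -> \bar R} :=
  measure_function_pushforward__canonical__measure_function_Measure mu mf.

HB.instance Definition _ := isMeasure.Build _ _ _ (image_measure mu mf)
  (measure0 m) (measure_ge0 m) (@measure_semi_sigma_additive _ _ _ m).

Lemma ge0_integral_image_measure (h : T -> \bar R) :
  measurable_fun setT h -> (forall y, 0 <= h y)%E ->
  (\int[image_measure mu mf]_y h y = \int[mu]_x h (f x))%E.
Proof.
by move=> mh h0; rewrite [LHS](ge0_integral_pushforward mf)//.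
Qed.

End measure.

Section finite.
Variables (mu : {finite_measure set S -> \bar R}) (f : S -> T).
Hypothesis mf : measurable_fun setT f.

Let fin_num_image : fin_num_fun (image_measure mu mf).
Proof.
by move=> A mA; rewrite fin_num_measure// -[X in measurable X]setTI; exact: mf.
Qed.

HB.instance Definition _ :=
  Measure_isFinite.Build _ _ _ (image_measure mu mf) fin_num_image.

End finite.

End image_measure.

(** * The normal law: affine images, convolution, second moment *)

Section affine.
Context (R : realType).
Notation mu := (@lebesgue_measure R).
Implicit Types (a b : R) (A : set R).

Lemma measurable_affine a b : measurable_fun setT (fun x : R => a * x + b).
Proof. by apply: measurable_funD => //; exact: measurable_funM. Qed.

(* The Lebesgue measure lives on this presentation of the Borel line. *)
Let affine a b (x : measurableTypeR R) : measurableTypeR R := a * x + b.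
Let maffine a b : measurable_fun setT (affine a b) := measurable_affine a b.

(** Both sides are measures in A that agree on the half-open intervals, where
    the sign of a decides which endpoint is kept. *)
Lemma lebesgue_measure_affine a b A : a != 0 -> measurable A ->
  mu A = (`|a|%:E * mu ((fun x => (a * x + b)%R) @^-1` A))%E.
Proof.
move=> a0 mA; have na0 : 0 < `|a| by rewrite normr_gt0.
pose r := NngNum (ltW na0).
pose m : {measure set (measurableTypeR R) -> \bar R} :=
  mscale r (image_measure mu (@maffine a b)).
have -> : (`|a|%:E * mu ((fun x => a * x + b)%R @^-1` A))%E = m A by [].
apply: lebesgue_measure_unique => // _ [[x y] _ <-]/=.
rewrite /mscale/= /image_measure /pushforward.
rewrite lebesgue_measure_itv/= lte_fin.
have [a_gt0|a_lt0|/esym/eqP] := ltgtP 0 a; last by rewrite (negbTE a0).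
- rewrite (_ : _ @^-1` _ = `](x - b) / a, (y - b) / a]%classic); last first.
    apply/seteqP; split => z /=; rewrite !in_itv/= /affine;
      by rewrite ltr_pdivrMr// ler_pdivlMr// ltrBlDr lerBrDr mulrC.
  rewrite lebesgue_measure_itv/= lte_fin ltr_pM2r ?invr_gt0// ltrD2r.
  case: ifPn => _; last by rewrite mule0.
  by rewrite -!EFinD -EFinM gtr0_norm//; congr EFin; field.
- rewrite (_ : _ @^-1` _ = `[(y - b) / a, (x - b) / a[%classic); last first.
    apply/seteqP; split => z /=; rewrite !in_itv/= /affine;
      by rewrite ler_ndivrMr// ltr_ndivlMr// ltrBlDr lerBrDr mulrC andbC.
  rewrite lebesgue_measure_itv/= lte_fin ltr_nM2r ?invr_lt0// ltrD2r.
  case: ifPn => _; last by rewrite mule0.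
  by rewrite -!EFinD -EFinM ltr0_norm//; congr EFin; field.
Qed.

Lemma ge0_integral_affine a b (h : R -> \bar R) : a != 0 ->
  measurable_fun setT h -> (forall x, 0 <= h x)%E ->
  (\int[mu]_x h x = `|a|%:E * \int[mu]_x h (a * x + b)%R)%E.
Proof.
move=> a0 mh h0; have na0 : 0 < `|a| by rewrite normr_gt0.
rewrite -(ge0_integral_image_measure _ (@maffine a b))//.
pose r := NngNum (ltW na0).
rewrite -[X in (X * _)%E]/(r%:num%:E) -ge0_integral_mscale//.
apply: eq_measure_integral => A mA _.
by rewrite [LHS](@lebesgue_measure_affine a b).
Qed.

End affine.

Section normal_affine.
Context (R : realType).
Notation mu := (@lebesgue_measure R).
Implicit Types (a b s t z : R) (B : set R).

Lemma normal_probE m s B : measurable B ->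
  normal_prob m s B = (\int[mu]_z (\1_B z * normal_pdf m s z)%:E)%E.
Proof.
move=> mB; rewrite /normal_prob integral_mkcond; apply: eq_integral => z _.
by rewrite patchE indicE; case: ifPn => _; rewrite ?mul1r ?mul0r.
Qed.

Lemma measurable_indic_normal_pdf m s B : measurable B ->
  measurable_fun setT (fun z => (\1_B z * normal_pdf m s z)%:E).
Proof.
move=> mB; apply/measurable_EFinP/measurable_funM => //.
exact: measurable_normal_pdf.
Qed.

Lemma normal_peak_scale a :
  normal_peak a = `|a|^-1 * (Num.sqrt (pi *+ 2))^-1.
Proof.
by rewrite /normal_peak -mulrnAr sqrtrM ?sqr_ge0// sqrtr_sqr invfM.
Qed.

Lemma normal_pdf_affine a b x : a != 0 ->
  `|a| * normal_pdf b a (a * x + b) = normal_pdf 0 1 x.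
Proof.
move=> a0; have n0 : `|a| != 0 by rewrite normr_eq0.
rewrite !normal_pdfE ?oner_eq0// mulrA; congr (_ * _).
  by rewrite !normal_peak_scale mulrA divff// normr1 invr1.
by rewrite /normal_fun; congr expR; field.
Qed.

Lemma normal_prob_affine a b B : a != 0 -> measurable B ->
  normal_prob 0 1 ((fun x => a * x + b) @^-1` B) = normal_prob b a B.
Proof.
move=> a0 mB; have mfB : measurable ((fun x => a * x + b) @^-1` B).
  by rewrite -[X in measurable X]setTI; exact: measurable_affine.
have h0 x : (0 <= (\1_B x * normal_pdf b a x)%:E)%E.
  by rewrite lee_fin mulr_ge0// normal_pdf_ge0.
have mh := measurable_indic_normal_pdf b a mB.
rewrite !normal_probE// [RHS](@ge0_integral_affine _ a b)//.
rewrite -ge0_integralZl//; last first.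
  exact: (measurableT_comp mh (measurable_affine a b)).
apply: eq_integral => x _.
by rewrite -EFinM mulrCA normal_pdf_affine.
Qed.

(** Completing the square: seen as a function of t, the product of the two
    densities is the density at t of the conditional law of T given that
    b * T + a * T' = z, for independent standard normal T and T', times the
    density of b * T + a * T' at z. *)
Lemma normal_pdf_convolution a b t z : a != 0 ->
  let s := Num.sqrt (a ^+ 2 + b ^+ 2) in
  normal_pdf (b * t) a z * normal_pdf 0 1 t =
  normal_pdf 0 s z * normal_pdf (b * z / s ^+ 2) (a / s) t.
Proof.
move=> a0 s; have s2 : s ^+ 2 = a ^+ 2 + b ^+ 2.
  by rewrite sqr_sqrtr// addr_ge0// sqr_ge0.
have a2 : 0 < a ^+ 2 by rewrite exprn_even_gt0.
have s2_gt0 : 0 < s ^+ 2 by rewrite s2 ltr_wpDr// sqr_ge0.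
have s0 : s != 0 by move: s2_gt0; rewrite exprn_even_gt0.
rewrite !normal_pdfE ?oner_eq0 ?mulf_neq0 ?invr_eq0// mulrACA [RHS]mulrACA.
congr (_ * _).
  rewrite !normal_peak_scale normr1 invr1 normrM normfV mulrACA [RHS]mulrACA.
  by congr (_ * _); field; rewrite !normr_eq0 a0 s0.
rewrite /normal_fun -!expRD; congr expR.
have := gt_eqF s2_gt0; rewrite s2 => e1.
rewrite expr_div_n s2 !subr0; field.
by rewrite a0 e1.
Qed.

(** After exchanging the integrals, the factorization of
    [normal_pdf_convolution] leaves a normal density in t, of integral 1.  The
    coefficient b may vanish; a may not, as it is a standard deviation. *)
Lemma normal_prob_convolution a b B : a != 0 -> measurable B ->
  (\int[normal_prob 0 1]_t normal_prob (b * t) a B =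
   normal_prob 0 (Num.sqrt (a ^+ 2 + b ^+ 2)) B)%E.
Proof.
move=> a0 mB; set s := Num.sqrt _.
pose k (u : measurableTypeR R * measurableTypeR R) : \bar R :=
  (\1_B u.2 * normal_pdf (b * u.1) a u.2)%:E.
pose f (u : measurableTypeR R * measurableTypeR R) : \bar R :=
  (k u * (normal_pdf 0 1 u.1)%:E)%E.
have k0 u : (0 <= k u)%E by rewrite lee_fin mulr_ge0// normal_pdf_ge0.
have f0 u : (0 <= f u)%E by rewrite mule_ge0// lee_fin normal_pdf_ge0.
have mk : measurable_fun setT k.
  apply/measurable_EFinP; apply: measurable_funM.
    apply: measurableT_comp; last exact: measurable_snd.
    exact: (@measurable_indic _ (measurableTypeR R) R setT B mB).
  rewrite (_ : (fun _ => normal_pdf _ _ _) = (fun u =>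
    normal_peak a * expR (- (u.2 - b * u.1) ^+ 2 / (a ^+ 2 *+ 2)))); last first.
    by apply/funext => u; rewrite normal_pdfE.
  apply: measurable_funM => //; apply: measurableT_comp => //.
  apply: measurable_funM => //; apply: measurableT_comp => //.
  apply: measurable_funX; apply: measurable_funB => //.
  by apply: measurable_funM => //; exact: measurable_fst.
have mf : measurable_fun setT f.
  apply: emeasurable_funM => //; apply/measurable_EFinP.
  exact: (measurableT_comp (measurable_normal_pdf _ _) measurable_fst).
have kE t : normal_prob (b * t) a B = (\int[mu]_z k (t, z))%E.
  by rewrite normal_probE.
transitivity (\int[mu]_t \int[mu]_z f (t, z))%E.
  under eq_integral do rewrite kE.
  rewrite (@ge0_integral_density _ _ _ mu _ (normal_pdf 0 1))//; first last.
  - by move=> t; apply: integral_ge0 => z _; exact: k0.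
  - exact: (measurable_fun_fubini_tonelli_F k).
  - by move=> x; exact: normal_pdf_ge0.
  - exact: measurable_normal_pdf.
  apply: eq_integral => t _; rewrite -ge0_integralZr//.
  - exact: (measurableT_comp mk (pair1_measurable t)).
  - by rewrite lee_fin normal_pdf_ge0.
rewrite fubini_tonelli// normal_probE//; apply: eq_integral => z _.
transitivity (\int[mu]_t ((\1_B z * normal_pdf 0 s z)%:E *
    (normal_pdf (b * z / s ^+ 2) (a / s) t)%:E))%E.
  apply: eq_integral => t _; rewrite /f /k/= -!EFinM.
  have sqE : normal_pdf (b * t) a z * normal_pdf 0 1 t =
    normal_pdf 0 s z * normal_pdf (b * z / s ^+ 2) (a / s) t.
    exact: normal_pdf_convolution.
  by rewrite -(mulrA (\1_B z)) sqE mulrA.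
rewrite ge0_integralZl//=; first by rewrite integral_normal_pdf mule1.
- by apply/measurable_EFinP; exact: measurable_normal_pdf.
- by move=> x _; rewrite lee_fin normal_pdf_ge0.
- by rewrite lee_fin mulr_ge0// normal_pdf_ge0.
Qed.

End normal_affine.

Section normal_moment.
Context (R : realType).
Notation mu := (@lebesgue_measure R).

Let p (x : R) := expR (- (x ^+ 2 / 2)).
Let h (x : R) := (1 - x ^+ 2) * p x.
Let H (x : R) := x * p x.

Let p_ge0 x : 0 <= p x. Proof. exact: expR_ge0. Qed.

(* H is an antiderivative of h, the difference of the two integrands p and
   x ^+ 2 * p x to be compared; h changes sign only at 1. *)
Let derH (x : R) : is_derive x (1 : R) H (h x).
Proof.
rewrite /H /h /p; apply: is_derive_eq.
by rewrite /GRing.scale/= /GRing.scale/=; field.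
Qed.

Let cp : continuous p.
Proof.
move=> x; apply: differentiable_continuous; apply/derivable1_diffP.
by apply: ex_derive.
Qed.

Let ch : continuous h.
Proof.
move=> x; apply: differentiable_continuous; apply/derivable1_diffP.
by apply: ex_derive.
Qed.

Let cH : continuous H.
Proof.
move=> x; apply: differentiable_continuous; apply/derivable1_diffP.
by apply: ex_derive.
Qed.

Let Hy : H x @[x --> +oo%R] --> 0.
Proof.
apply: (@squeeze_cvgr _ _ _ _ (cst 0) (fun x => 2 * x^-1)).
- near=> x; have x0 : 0 < x by near: x; exact: nbhs_pinfty_gt.
  rewrite /H mulr_ge0 ?p_ge0 ?(ltW x0)//= /p expRN.
  rewrite ler_pdivrMr ?expR_gt0// mulrAC ler_pdivlMr//.
  have := expR_ge1Dx (x ^+ 2 / 2); rewrite expr2; lra.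
- exact: cvg_cst.
- rewrite -[X in _ --> X](mulr0 2); apply: cvgMr.
  apply/(@gtr0_cvgV0 _ _ _ _ (fun x : R => x)); last exact: cvg_id.
  exact: nbhs_pinfty_gt.
Unshelve. all: by end_near. Qed.

Let derH1 (x : R) : (derive1 H) x = h x.
Proof. by rewrite derive1E; apply: derive_val. Qed.

Let int01 : (\int[mu]_(x in `[0%R, 1%R]) (h x)%:E = (H 1)%:E)%E.
Proof.
rewrite (@continuous_FTC2 _ h H)//.
- by rewrite /H mul0r sube0.
- by apply/continuous_subspaceT => x; exact: ch.
- split.
  + by move=> x _; apply: ex_derive.
  + by apply: cvg_at_right_filter; exact: cH.
  + by apply: cvg_at_left_filter; exact: cH.
Qed.

Let int1y : (\int[mu]_(x in `[1%R, +oo[) (- h x)%:E = (H 1)%:E)%E.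
Proof.
rewrite (@ge0_continuous_FTC2y _ (\- h) (\- H) 1 0)//.
- by rewrite sub0e EFinN oppeK.
- move=> x x1; rewrite [X in 0 <= X](_ : _ = (x ^+ 2 - 1) * p x); last first.
    by rewrite /h/=; ring.
  rewrite mulr_ge0// subr_ge0.
  by rewrite expr_ge1// (le_trans ler01).
- by apply/continuous_subspaceT => x; apply: continuousN; exact: ch.
- by rewrite -oppr0; apply: cvgN; exact: Hy.
- by apply: cvg_at_right_filter; apply: continuousN; exact: cH.
- by move=> x _; rewrite derive1E; have [] := is_deriveN (derH x).
Qed.

Let integral0y (f : R -> R) : continuous f -> (forall x, 0 <= f x) ->
  (\int[mu]_(x in `[0%R, +oo[) (f x)%:E =
   \int[mu]_(x in `[0%R, 1%R]) (f x)%:E +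
   \int[mu]_(x in `[1%R, +oo[) (f x)%:E)%E.
Proof.
move=> cf f0; have mf D : measurable_fun D (EFin \o f).
  by apply/measurable_funTS/measurable_EFinP; exact: continuous_measurable_fun.
rewrite -(integral_itv_obnd_cbnd (r := 1) (b := +oo%O) (mf _)).
rewrite -ge0_integral_setU//=.
- congr (integral _ _ _); apply/seteqP; split => x/=; rewrite !in_itv/= !andbT.
    by move=> x0; have [] := leP x 1; [left; rewrite x0|right].
  by case=> [/andP[]//|/ltW]; exact: le_trans.
- exact: mf.
- by move=> x _; rewrite lee_fin.
- apply/disj_setPS => x/= []; rewrite !in_itv/= andbT => /andP[_ x1] x2.
  by have := le_lt_trans x1 x2; rewrite ltxx.
Qed.

Let q (x : R) := x ^+ 2 * p x.
Let cq : continuous q.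
Proof.
move=> x; apply: differentiable_continuous; apply/derivable1_diffP.
by apply: ex_derive.
Qed.
Let q_ge0 x : 0 <= q x. Proof. by rewrite mulr_ge0// sqr_ge0. Qed.

(* On [0, 1] the first integral exceeds the second by H 1, on [1, +oo[ it falls
   short of it by H 1; working on each side of 1 keeps all integrands
   nonnegative. *)
Let integral_pq : (\int[mu]_x (p x)%:E = \int[mu]_x (q x)%:E)%E.
Proof.
apply/esym.
have mh D (f : R -> R) : continuous f -> measurable_fun D (EFin \o f).
  move=> cf; apply/measurable_funTS/measurable_EFinP.
  exact: continuous_measurable_fun.
rewrite !ge0_symfun_integralT//; last 2 first.
  by move=> x; rewrite /q /p/= sqrrN.
  by move=> x; rewrite /p/= sqrrN.
congr (_ * _)%E.
rewrite (_ : [set x | _] = `[0%R, +oo[%classic); last first.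
  by apply/seteqP; split => x/=; rewrite in_itv/= andbT.
rewrite !integral0y//.
have -> : (\int[mu]_(x in `[0%R, 1%R]) (p x)%:E =
  \int[mu]_(x in `[0%R, 1%R]) (q x)%:E + (H 1)%:E)%E.
  rewrite -int01 -ge0_integralD//=; last 4 first.
  - by move=> x _; rewrite lee_fin.
  - exact: mh.
  - move=> x; rewrite in_itv/= => /andP[x0 x1]; rewrite lee_fin mulr_ge0//.
    by rewrite subr_ge0 expr_le1.
  - exact: mh.
  by apply: eq_integral => x _; rewrite -EFinD /q /h; congr EFin; ring.
have -> : (\int[mu]_(x in `[1%R, +oo[) (q x)%:E =
  (H 1)%:E + \int[mu]_(x in `[1%R, +oo[) (p x)%:E)%E.
  rewrite -int1y -ge0_integralD//=; last 4 first.
  - move=> x; rewrite in_itv/= andbT => x1; rewrite lee_fin /h.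
    rewrite (_ : - (_ * p x) = (x ^+ 2 - 1) * p x); last by ring.
    by rewrite mulr_ge0// subr_ge0 expr_ge1// (le_trans ler01).
  - by apply: (mh _ (\- h)) => x; apply: continuousN; exact: ch.
  - by move=> x _; rewrite lee_fin.
  - exact: mh.
  by apply: eq_integral => x _; rewrite -EFinD /q /h; congr EFin; ring.
by rewrite addeA.
Qed.

(** Integration by parts: x ^+ 2 * expR (- x ^+ 2 / 2) and expR (- x ^+ 2 / 2)
    have the same integral over the line, because x * expR (- x ^+ 2 / 2)
    vanishes at infinity. *)
Lemma normal_prob_second_moment :
  (\int[normal_prob 0 1]_x (x ^+ 2)%:E = 1 :> \bar R)%E.
Proof.
have pdfE x : normal_pdf 0 1 x = normal_peak 1 * p x :> R.
  rewrite normal_pdfE ?oner_eq0//; congr (_ * _); rewrite /normal_fun /p.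
  by rewrite subr0 expr1n mulNr.
have mp (f : R -> R) : continuous f -> measurable_fun setT (EFin \o f).
  by move=> cf; apply/measurable_EFinP; exact: continuous_measurable_fun.
rewrite (@ge0_integral_density _ _ _ mu _ (normal_pdf 0 1))//; last 4 first.
- exact: measurable_normal_pdf.
- by move=> x; exact: normal_pdf_ge0.
- by apply/measurable_EFinP; exact: measurable_funX.
- by move=> x; rewrite lee_fin sqr_ge0.
transitivity ((normal_peak 1)%:E * \int[mu]_x (q x)%:E : \bar R)%E.
  rewrite -ge0_integralZl//=.
  - by apply: eq_integral => x _; rewrite pdfE -!EFinM /q; congr EFin; ring.
  - exact: mp.
  - by move=> x _; rewrite lee_fin.
  - by rewrite lee_fin normal_peak_ge0.
rewrite -integral_pq -ge0_integralZl//=.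
- rewrite -(integral_normal_pdf 0 (1 : R)); apply: eq_integral => x _.
  by rewrite pdfE EFinM.
- exact: mp.
- by move=> x _; rewrite lee_fin.
- by rewrite lee_fin normal_peak_ge0.
Qed.

End normal_moment.

(** * Independence of sigma-algebras *)

Section independence.
Context d (O : measurableType d) (R : realType) (P : probability O R).
Implicit Types F G : set (set O).

Definition indep_systems F G :=
  forall A B, F A -> G B -> P (A `&` B) = (P A * P B)%E.

Lemma indep_systemsC F G : indep_systems F G -> indep_systems G F.
Proof. by move=> FG A B GA FB; rewrite setIC FG// muleC. Qed.

(** For a fixed B in G, the events A independent of B form a lambda-system. *)
Lemma indep_generated F G : setI_closed F -> F `<=` measurable ->
  G `<=` measurable -> indep_systems F G -> indep_systems <<s F>> G.
Proof.
move=> FI mF mG FG A B sFA GB.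
have mB := mG _ GB.
suff : <<s F>> `<=` [set A | measurable A /\ P (A `&` B) = (P A * P B)%E].
  by move=> /(_ _ sFA)[].
apply: lambda_system_subset => //; last first.
  by move=> C FC; split; [exact: mF|exact: FG].
apply/dynkin_lambda_system; split => /=.
- by split => //; rewrite setTI probability_setT mul1e.
- move=> C [mC PC]; split; first exact: measurableC.
  rewrite [_ `&` B]setIC -setDE measureD//; last first.
    by rewrite -ge0_fin_numE ?fin_num_measure.
  rewrite (setIC B C); transitivity (P B - P C * P B)%E.
    by congr (_ - _)%E; exact: PC.
  rewrite probability_setC// muleBl ?mul1e//.
    by rewrite fin_num_measure.
- move=> C tC mPC.
  have mC n : measurable (C n) by have [] := mPC n.
  have PC n : P (C n `&` B) = (P (C n) * P B)%E by have [] := mPC n.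
  split; first exact: bigcupT_measurable.
  rewrite setI_bigcupl !measure_bigcup//; last 2 first.
  + by move=> n _; exact: measurableI.
  + exact/trivIset_setIr.
  transitivity (\sum_(n <oo | n \in [set: nat]) (P B * P (C n)))%E.
    by apply: eq_eseriesr => n _; rewrite muleC; exact: PC.
  by rewrite -(fineK (fin_num_measure P B mB)) nneseriesZl// muleC.
Qed.

Lemma indep_systemsS F F' G G' : F `<=` F' -> G `<=` G' ->
  indep_systems F' G' -> indep_systems F G.
Proof. by move=> FF' GG' FG A B /FF' FA /GG'; exact: FG. Qed.

Section generated_by_family.
Variables (I : choiceType) (g : I -> {RV P >-> R}).
Implicit Types D E : set I.

(** A pi-system generating the sigma-algebra of the variables indexed by D. *)
Definition family_cylinders D : set (set O) :=
  [set C | exists (J : {fset I}) (B : I -> set R),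
    [/\ [set` J] `<=` D, forall i, measurable (B i) &
        C = \bigcap_(i in [set` J]) g i @^-1` B i]].

Notation sigma_family D := <<s family_cylinders D >>.

Lemma measurable_cylinders D : family_cylinders D `<=` measurable.
Proof.
move=> _ [J [B [_ mB ->]]]; rewrite bigcap_fset.
by apply: bigsetI_measurable => i _; exact: measurable_funPTI.
Qed.

Lemma setI_closed_cylinders D : setI_closed (family_cylinders D).
Proof.
move=> _ _ [J [B [JD mB ->]]] [J' [B' [J'D mB' ->]]].
exists (J `|` J')%fset, (fun i => (if i \in J then B i else setT) `&`
  (if i \in J' then B' i else setT)); split.
- by move=> i /=; rewrite in_fsetU => /orP[/JD|/J'D].
- by move=> i; apply: measurableI; case: ifP.
- apply/seteqP; split => w /=.
    move=> [Bw B'w] i /= _; split.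
      by case: ifPn => // iJ; exact: Bw.
    by case: ifPn => // iJ'; exact: B'w.
  move=> BBw; split => i /= iJ.
    by have /= := BBw i; rewrite in_fsetU iJ => /(_ isT)[].
  by have /= := BBw i; rewrite in_fsetU iJ orbT => /(_ isT)[].
Qed.

(** The product formula, applied to the union of the two disjoint finite index
    sets, factors. *)
Lemma indep_cylinders D E : independent g -> D `&` E = set0 ->
  indep_systems (family_cylinders D) (family_cylinders E).
Proof.
move=> ig DE _ _ [J [B [JD mB ->]]] [J' [B' [J'E mB' ->]]].
have JJ' i : i \in J' -> i \notin J.
  move=> iJ'; apply/negP => iJ.
  suff : (D `&` E) i by rewrite DE.
  by split; [exact: JD|exact: J'E].
pose C i := if i \in J then B i else B' i.
have mC i : measurable (C i) by rewrite /C; case: ifP.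
rewrite !(ig _ B)// !(ig _ B')//.
transitivity (P (\bigcap_(i in [set` (J `|` J')%fset]) g i @^-1` C i)).
  congr (P _); apply/seteqP; split => w /=.
    move=> [Bw B'w] i /=; rewrite in_fsetU /C.
    by case: ifPn => [iJ _|_ /= iJ']; [exact: Bw|exact: B'w].
  move=> Cw; split => i /= iJ; have /= := Cw i; rewrite in_fsetU iJ ?orbT /C.
    by rewrite iJ => /(_ isT).
  by rewrite (negbTE (JJ' _ iJ)) => /(_ isT).
rewrite ig// (perm_big (enum_fset J ++ enum_fset J'))/=; last first.
  rewrite uniq_perm ?cat_uniq ?fset_uniq//=.
    by rewrite andbT; apply/hasPn => i /= /JJ'.
  by move=> i; rewrite mem_cat in_fsetU.
rewrite big_cat/=; congr (_ * _)%E; rewrite !big_seq; apply: eq_bigr => i iJ.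
  by rewrite /C iJ.
by rewrite /C (negbTE (JJ' _ iJ)).
Qed.

(** Two uses of the pi-lambda theorem, one for each side. *)
Lemma indep_sigma_family D E : independent g -> D `&` E = set0 ->
  indep_systems (sigma_family D) (sigma_family E).
Proof.
move=> ig DE; have mcyl := @measurable_cylinders.
have Icyl := @setI_closed_cylinders.
have sub D' : sigma_family D' `<=` measurable.
  by apply: smallest_sub; [exact: sigma_algebra_measurable|exact: mcyl].
apply: indep_generated => //.
apply: indep_systemsC; apply: indep_generated => //; apply: indep_systemsC.
exact: indep_cylinders.
Qed.

Notation family_measurable D f :=
  (measurable_fun setT (f : g_sigma_algebraType (family_cylinders D) -> _)).

Lemma measurable_family D i : D i ->
  family_measurable D (g i).
Proof.
move=> Di _ B mB; rewrite setTI; apply: sub_sigma_algebra.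
exists [fset i]%fset, (fun=> B); split => //.
  by move=> j /=; rewrite inE => /eqP ->.
by apply/seteqP; split => w /= Bw; [move=> j /=; rewrite inE => /eqP ->|
  apply: Bw; rewrite /= inE].
Qed.

Lemma indep_family_fun d' (T : measurableType d') D E (V : O -> T) :
  independent g -> D `&` E = set0 -> family_measurable E V ->
  indep_systems (sigma_family D) (g_sigma_algebra_preimage V).
Proof.
move=> ig DE mV; apply: indep_systemsS (indep_sigma_family ig DE) => //.
by move=> _ [B mB <-]; exact: mV.
Qed.

End generated_by_family.

End independence.
Notation sigma_family g D := <<s family_cylinders g D >>.
Notation family_measurable g D f :=
  (measurable_fun setT (f : g_sigma_algebraType (family_cylinders g D) -> _)).

(** * Conditional expectation and independence *)

Section restricted_law.
Context d (O : measurableType d) (R : realType) (P : probability O R).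
Variables (A : set O) (mA : measurable A).

Lemma ge0_integral_mrestr (f : O -> \bar R) :
  measurable_fun setT f -> (forall x, 0 <= f x)%E ->
  (\int[mrestr P mA]_x f x = \int[P]_(x in A) f x)%E.
Proof.
move=> mf f0; rewrite (@ge0_integral_density _ _ _ P _ \1_A)//.
  rewrite [RHS]integral_mkcond; apply: eq_integral => x _.
  by rewrite patchE indicE; case: ifPn => _; rewrite ?mule1 ?mule0.
by move=> B mB; rewrite integral_indic// setIC.
Qed.

Context d1 d2 (S : measurableType d1) (T : measurableType d2).
Variables (U : O -> S) (V : O -> T).
Hypotheses (mU : measurable_fun setT U) (mV : measurable_fun setT V).
Hypothesis UV : forall E G, measurable E -> measurable G ->
  P (A `&` U @^-1` E `&` V @^-1` G) = (P (A `&` U @^-1` E) * P (V @^-1` G))%E.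

(** Under the restriction of P to A, the law of (U, V) is the product of the law
    of U under this restriction and of the law of V under P: both measures agree
    on rectangles.  The right-hand side is the product measure of C. *)
Lemma joint_law C : measurable C ->
  P (A `&` (fun w => (U w, V w)) @^-1` C) =
  (\int[P]_(w in A) P (V @^-1` xsection C (U w)))%E.
Proof.
move=> mC; pose PA : {finite_measure set O -> \bar R} := mrestr P mA.
have mUV : measurable_fun setT (fun w => (U w, V w)).
  exact: measurable_fun_pair.
have := @product_measure_unique _ _ _ _ _ (image_measure PA mU)
  (image_measure P mV) (image_measure PA mUV) _ _ mC.
rewrite /product_measure1 ge0_integral_image_measure//; last first.
  exact: measurable_fun_xsection.
rewrite ge0_integral_mrestr//; last first.
  apply: measurableT_comp => //; exact: measurable_fun_xsection.
rewrite {3}/image_measure /pushforward/= /mrestr => ->.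
  by rewrite setIC.
move=> E G mE mG; rewrite /image_measure /pushforward/= /mrestr.
rewrite [(U @^-1` E) `&` A]setIC -UV// setIC setIA; congr (P (_ `&` _ `&` _)).
Qed.

End restricted_law.

Section conditional_expectation.
Context d (O : measurableType d) (R : realType) (P : probability O R).
(* F collects events independent of the new variable, F' those among them on
   which one conditions. *)
Variables (F' F : set (set O)).
Hypotheses (F'F : F' `<=` F) (FI : setI_closed F) (mF : F `<=` measurable).

Section freezing.
Context d1 d2 (S : measurableType d1) (T : measurableType d2).
Variables (U : O -> S) (V : O -> T).
Hypothesis F'U : forall E, measurable E -> F' (U @^-1` E).
Hypothesis mV : measurable_fun setT V.
Hypothesis FV : indep_systems P F (g_sigma_algebra_preimage V).

(** Freezing: to average a function of (U, V) given F', where U is known and V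
    is independent, replace V by an independent copy and U by its value.  The
    version obtained depends on U alone, so the same one serves for every F'
    between the sigma-algebra of U and F. *)
Lemma cond_exp_freezing (C : set (S * T)) : measurable C ->
  is_cond_exp P F' \1_((fun w => (U w, V w)) @^-1` C)
    (fun w => fine (P (V @^-1` xsection C (U w)))).
Proof.
move=> mC; have mU : measurable_fun setT U.
  by move=> _ E mE; rewrite setTI; apply/mF/F'F/F'U.
have mUV : measurable_fun setT (fun w => (U w, V w)).
  exact: measurable_fun_pair.
have mUVC : measurable ((fun w => (U w, V w)) @^-1` C).
  by rewrite -[X in measurable X]setTI; exact: mUV.
have mVC w : measurable (V @^-1` xsection C (U w)).
  rewrite -[X in measurable X]setTI; apply: mV => //.
  exact: measurable_xsection.
pose k s := fine (P (V @^-1` xsection C s)).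
have mk : measurable_fun setT k.
  apply: measurableT_comp => //.
  exact: (measurable_fun_xsection (image_measure P mV)).
split.
- exact: integrable_indic.
- apply: measurable_bounded_integrable => //.
  + by rewrite -ge0_fin_numE ?fin_num_measure.
  + exact: (measurableT_comp mk mU).
  + exists 1; split => // M M1 w _ /=; rewrite ger0_norm ?fine_ge0//.
    apply: le_trans (ltW M1); rewrite -lee_fin fineK ?fin_num_measure//.
    exact: probability_le1.
- move=> B mB; apply: (F'U (E := k @^-1` B)).
  by rewrite -[X in measurable X]setTI; exact: mk.
- move=> A F'A; have mA := mF (F'F F'A).
  transitivity (P (A `&` (fun w => (U w, V w)) @^-1` C)); last first.
    by rewrite integral_indic// setIC.
  rewrite joint_law//.
    by apply: eq_integral => w _; rewrite fineK// fin_num_measure.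
  move=> E G mE mG; apply: FV; first by apply: FI; [exact: F'F|exact/F'F/F'U].
  by exists G => //; rewrite setTI.
Qed.

End freezing.

Section independent_integral.
Variable Y : O -> R.
Hypothesis FY : indep_systems P F (g_sigma_algebra_preimage Y).
Hypothesis iY : P.-integrable setT (EFin \o Y).

Let mY : measurable_fun setT Y.
Proof. exact/measurable_EFinP/(measurable_int P). Qed.

Let ge0_integral_indep (f : R -> \bar R) A : F A ->
  measurable_fun setT f -> (forall x, 0 <= f x)%E ->
  (\int[P]_(w in A) f (Y w) = P A * \int[P]_w f (Y w))%E.
Proof.
move=> FA mf f0; have mA := mF FA.
rewrite -ge0_integral_mrestr//; last exact: measurableT_comp.
have P0 : 0 <= fine (P A) by rewrite fine_ge0.
pose r : {nonneg R} := NngNum P0.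
have PAE : P A = r%:num%:E by rewrite /= fineK// fin_num_measure.
rewrite -!(ge0_integral_image_measure _ mY)// PAE -ge0_integral_mscale//.
apply: eq_measure_integral => B mB _.
rewrite /image_measure /pushforward /mscale/= /mrestr setIC.
rewrite -[RHS]/(r%:num%:E * P (Y @^-1` B))%E -PAE.
by apply: FY => //; exists B => //; rewrite setTI.
Qed.

(** Under the restriction of P to A, the law of Y is P A times its law under
    P. *)
Lemma integral_indep A : F A ->
  (\int[P]_(w in A) (Y w)%:E = P A * \int[P]_w (Y w)%:E)%E.
Proof.
move=> FA; have mA := mF FA.
have PAfin : P A \is a fin_num by rewrite fin_num_measure.
rewrite [in LHS]integralE [in RHS]integralE muleBr//; last first.
  apply: fin_num_adde_defl; rewrite fin_numN.
  exact: integrable_neg_fin_num iY.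
have mid : measurable_fun [set: R] (@EFin R) by [].
rewrite (funepos_comp (@EFin R) Y) (funeneg_comp (@EFin R) Y).
congr (_ - _)%E.
  exact: (@ge0_integral_indep (@EFin R)^\+%E A FA (measurable_funepos mid)
    (funepos_ge0 _)).
exact: (@ge0_integral_indep (@EFin R)^\-%E A FA (measurable_funeneg mid)
  (funeneg_ge0 _)).
Qed.

Lemma cond_exp_indep (F'T : F' setT) (F'0 : F' set0) :
  is_cond_exp P F' Y (fun=> fine (\int[P]_w (Y w)%:E)).
Proof.
have EYfin : (\int[P]_w (Y w)%:E)%E \is a fin_num.
  exact: integrable_fin_num.
split => //.
- by apply: finite_measure_integrable_cst.
- by move=> B mB; rewrite preimage_cst; case: ifP.
- move=> A F'A; have mA := mF (F'F F'A).
  by rewrite (integral_indep (F'F F'A)) integral_cst// fineK// muleC.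
Qed.

Lemma cond_exp_add_indep (X : O -> R) :
  (forall B, measurable B -> F' (X @^-1` B)) ->
  P.-integrable setT (EFin \o X) -> (\int[P]_w (Y w)%:E = 0)%E ->
  is_cond_exp P F' (X \+ Y) X.
Proof.
move=> F'X iX EY0; split => //.
  by rewrite (_ : _ \o _ = (EFin \o X) \+ (EFin \o Y))%E//; exact: integrableD.
move=> A F'A; have mA := mF (F'F F'A).
under [RHS]eq_integral do rewrite EFinD.
rewrite integralD//; last 2 first.
- exact: integrableS iX.
- exact: integrableS iY.
by rewrite (integral_indep (F'F F'A)) EY0 mule0 adde0.
Qed.

End independent_integral.

End conditional_expectation.

(** * Linear combinations of i.i.d. standard normal variables *)

Section linear_combinations.
Context d (O : measurableType d) (R : realType) (P : probability O R).
Variables (I : choiceType) (g : I -> {RV P >-> R}).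
Hypothesis g_iid : iid_standard_normal g.
Implicit Types (s : seq I) (c e : I -> R).

Definition lincomb s c (w : O) : R := \sum_(i <- s) c i * g i w.

(* The carrier is the one on which the normal law is defined. *)
Let gamma : probability (measurableTypeR R) R := normal_prob 0 1.

Lemma measurable_lincomb_family s c (D : set I) : (forall i, i \in s -> D i) ->
  family_measurable g D (lincomb s c).
Proof.
move=> sD; elim: s sD => [|i s IHs] sD.
  rewrite (_ : lincomb _ _ = cst 0)//.
  by apply/funext => w; rewrite /lincomb big_nil.
rewrite (_ : lincomb _ _ = (fun w => c i * g i w + lincomb s c w)); last first.
  by apply/funext => w; rewrite /lincomb big_cons.
apply: measurable_funD.
  apply: measurable_funM => //; apply: measurable_family.
  by apply: sD; exact: mem_head.
by apply: IHs => j js; apply: sD; rewrite in_cons js orbT.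
Qed.

Lemma measurable_lincomb s c : measurable_fun setT (lincomb s c).
Proof. by apply: measurable_sum => i; exact: measurable_funM. Qed.

Let measurable_affine_pair (a : R) (B : set R) : measurable B ->
  measurable [set z : R * R | B (a * z.2 + z.1)].
Proof.
have mf : measurable_fun setT (fun z : R * R => a * z.2 + z.1).
  by apply: measurable_funD => //; exact: measurable_funM.
by move=> mB; rewrite -[X in measurable X]setTI; exact: mf.
Qed.

Let xsection_affine (a y : R) (B : set R) :
  xsection [set z : R * R | B (a * z.2 + z.1)] y = (fun x => a * x + y) @^-1` B.
Proof. by apply/seteqP; split => x; rewrite /xsection/= inE. Qed.

(** Induction on s, adding an independent multiple of a standard normal
    variable.  A zero coefficient changes nothing and is treated apart, since
    the convolution formula requires a nondegenerate added law. *)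
Lemma lincomb_law s c B : uniq s -> measurable B ->
  P (lincomb s c @^-1` B) =
  gamma ((fun x => Num.sqrt (\sum_(i <- s) c i ^+ 2) * x) @^-1` B).
Proof.
elim: s B => [|i s IHs] B.
  move=> _ mB; have -> : lincomb [::] c = cst 0.
    by apply/funext => w; rewrite /lincomb big_nil.
  rewrite big_nil sqrtr0 (_ : (fun x => 0 * x) = cst 0); last first.
    by apply/funext => x; rewrite mul0r.
  by rewrite !preimage_cst; case: ifP => _; rewrite ?probability_setT ?measure0.
move=> /= /andP[ins us] mB.
have lE : lincomb (i :: s) c = (fun w => c i * g i w + lincomb s c w).
  by apply/funext => w; rewrite /lincomb big_cons.
set b := Num.sqrt (\sum_(j <- s) c j ^+ 2) in IHs.
have b2 : \sum_(j <- s) c j ^+ 2 = b ^+ 2.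
  by rewrite sqr_sqrtr// sumr_ge0// => j _; exact: sqr_ge0.
rewrite big_cons b2; have [ci0|ci0] := eqVneq (c i) 0.
  have -> : lincomb (i :: s) c = lincomb s c.
    by rewrite lE; apply/funext => w; rewrite ci0 mul0r add0r.
  by rewrite ci0 expr0n add0r sqrtr_sqr ger0_norm ?sqrtr_ge0// -IHs.
have s0 : Num.sqrt (c i ^+ 2 + b ^+ 2) != 0.
  by rewrite sqrtr_eq0 -ltNge ltr_wpDr ?sqr_ge0// exprn_even_gt0.
set s' := Num.sqrt _ in s0 *.
rewrite (_ : (fun x => s' * x) = (fun x => s' * x + 0)); last first.
  by apply/funext => x; rewrite addr0.
rewrite normal_prob_affine//.
have mC := measurable_affine_pair (c i) mB; set C := [set z | _] in mC.
have mY := measurable_lincomb s c.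
transitivity (P (setT `&` (fun w => (lincomb s c w, g i w)) @^-1` C)).
  by rewrite setTI lE.
rewrite joint_law//; last first.
  move=> E G mE mG; rewrite !setTI.
  apply: (@indep_family_fun _ _ _ _ _ g _ _ [set` s] [set i] (g i) g_iid.2).
  - by apply/seteqP; split => // j /= [js ji]; move: ins; rewrite -ji js.
  - exact: measurable_family.
  - have mYs : family_measurable g [set` s] (lincomb s c).
      exact: measurable_lincomb_family.
    by rewrite -[lincomb s c @^-1` E]setTI; exact: mYs.
  - by exists G => //; rewrite setTI.
transitivity (\int[P]_w normal_prob (lincomb s c w) (c i) B)%E.
  apply: eq_integral => w _; rewrite xsection_affine.
  rewrite -normal_prob_affine// -(g_iid.1 i)//.
  by rewrite -[X in measurable X]setTI; exact: measurable_affine.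
have mN : measurable_fun setT (fun y => normal_prob y (c i) B).
  under eq_fun do rewrite -normal_prob_affine// -xsection_affine.
  exact: (measurable_fun_xsection gamma mC).
have mb : measurable_fun setT (fun x : R => b * x) by exact: measurable_funM.
(* By induction, lincomb s c has the law of b times a standard normal. *)
rewrite -(ge0_integral_image_measure P mY mN)//.
rewrite -normal_prob_convolution// -(ge0_integral_image_measure gamma mb mN)//.
by apply: eq_measure_integral => E mE _; exact: IHs.
Qed.

Let sigma2 s c : R := \sum_(i <- s) c i ^+ 2.

Let sigma2_ge0 s c : 0 <= sigma2 s c.
Proof. by apply: sumr_ge0 => i _; exact: sqr_ge0. Qed.

Lemma gaussian_lincomb s c : uniq s -> gaussian P (lincomb s c).
Proof.
move=> us; split; first exact: measurable_lincomb.
exists 0, (Num.sqrt (sigma2 s c)) => B mB.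
rewrite [LHS](lincomb_law c us mB) -/(sigma2 s c).
have [->|s0] := eqVneq (Num.sqrt (sigma2 s c)) 0.
  rewrite (_ : (fun x => 0 * x) = cst 0); last first.
    by apply/funext => x; rewrite mul0r.
  rewrite preimage_cst diracE; case: ifP => _.
    by rewrite probability_setT.
  by rewrite measure0.
rewrite -normal_prob_affine//; congr (gamma _).
by apply/seteqP; split => x /=; rewrite addr0.
Qed.

Lemma lincomb_second_moment s c : uniq s ->
  (\int[P]_w (lincomb s c w ^+ 2)%:E = (\sum_(i <- s) c i ^+ 2)%:E)%E.
Proof.
move=> us; have msq : measurable_fun setT (fun y : R => (y ^+ 2)%:E).
  by apply/measurable_EFinP; exact: measurable_funX.
have sq0 (y : R) : (0 <= (y ^+ 2)%:E)%E by rewrite lee_fin sqr_ge0.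
have mL := measurable_lincomb s c.
have mS : measurable_fun setT (fun x : R => Num.sqrt (sigma2 s c) * x).
  exact: measurable_funM.
rewrite -(ge0_integral_image_measure P mL msq)//.
transitivity (\int[image_measure gamma mS]_y (y ^+ 2)%:E)%E.
  by apply: eq_measure_integral => E mE _; exact: lincomb_law.
rewrite (ge0_integral_image_measure gamma mS msq)//.
under eq_integral do rewrite exprMn sqr_sqrtr// EFinM.
rewrite ge0_integralZl//= ?lee_fin//.
by rewrite normal_prob_second_moment mule1.
Qed.

Lemma integrable_lincomb_sqr s c : uniq s ->
  P.-integrable setT (fun w => (lincomb s c w ^+ 2)%:E).
Proof.
move=> us; apply/integrableP; split.
  by apply/measurable_EFinP/measurable_funX; exact: measurable_lincomb.
under eq_integral do rewrite gee0_abs ?lee_fin ?sqr_ge0//.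
by rewrite lincomb_second_moment// ltry.
Qed.

Lemma integrable_lincomb s c : uniq s ->
  P.-integrable setT (EFin \o lincomb s c).
Proof.
move=> us; have iL := integrable_lincomb_sqr c us.
apply: (@le_integrable _ _ _ P _ measurableT _
    (fun w => (1 + lincomb s c w ^+ 2)%:E)) => //.
- exact/measurable_EFinP/measurable_lincomb.
(* |L| is dominated by 1 + L^2. *)
- move=> w _; rewrite /= lee_fin [leRHS]ger0_norm ?addr_ge0 ?sqr_ge0//.
  rewrite ler_norml; nra.
- rewrite (_ : (fun _ => _) =
    (cst 1%E \+ (fun w => (lincomb s c w ^+ 2)%:E))%E)//.
  by apply: integrableD => //; exact: finite_measure_integrable_cst.
Qed.

(** Opposite coefficients give the same law, so the expectation equals its
    opposite. *)
Lemma lincomb_expectation s c : uniq s -> (\int[P]_w (lincomb s c w)%:E = 0)%E.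
Proof.
move=> us; pose c' i := - c i.
have LN w : lincomb s c' w = - lincomb s c w.
  by rewrite /lincomb -sumrN; apply: eq_bigr => i _; rewrite mulNr.
have mL := measurable_lincomb s c; have mL' := measurable_lincomb s c'.
have law_sym : (\int[P]_w (lincomb s c w)%:E = \int[P]_w (lincomb s c' w)%:E)%E.
  have mE : measurable_fun setT (@EFin R) by [].
  have := integral_pushforward mL mE (integrable_lincomb c us) measurableT.
  have := integral_pushforward mL' mE (integrable_lincomb c' us) measurableT.
  rewrite !preimage_setT => <- <-.
  apply: eq_measure_integral => E mE' _.
  rewrite [LHS](lincomb_law c us mE') [RHS](lincomb_law c' us mE').
  by under [in RHS]eq_bigr do rewrite sqrrN.
have : (\int[P]_w (lincomb s c w)%:E)%E \is a fin_num.
  exact/integrable_fin_num/integrable_lincomb.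
move: law_sym; under [X in _ = X]eq_integral do rewrite LN EFinN.
rewrite integralN; last first.
  by apply: integrable_add_def => //; exact: integrable_lincomb.
by case: (integral _ _ _) => //= r [rr] _; congr EFin; lra.
Qed.

(** Polarization, which reduces products to squares of linear combinations. *)
Lemma lincombM s c e w : lincomb s c w * lincomb s e w =
  4^-1 * (lincomb s (c \+ e) w ^+ 2 - lincomb s (c \- e) w ^+ 2).
Proof.
have -> : lincomb s (c \+ e) w = lincomb s c w + lincomb s e w.
  by rewrite /lincomb -big_split/=; apply: eq_bigr => i _; rewrite mulrDl.
have -> : lincomb s (c \- e) w = lincomb s c w - lincomb s e w.
  by rewrite /lincomb -sumrB/=; apply: eq_bigr => i _; rewrite mulrBl.
by field.
Qed.

Lemma integrable_lincombM s c e : uniq s ->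
  P.-integrable setT (fun w => (lincomb s c w * lincomb s e w)%:E).
Proof.
move=> us; under eq_fun do rewrite lincombM EFinM.
apply: integrableZl => //; under eq_fun do rewrite EFinB.
by apply: integrableB => //; exact: integrable_lincomb_sqr.
Qed.

Lemma lincomb_covariance s c e : uniq s ->
  (\int[P]_w (lincomb s c w * lincomb s e w)%:E =
   (\sum_(i <- s) c i * e i)%:E)%E.
Proof.
move=> us; under eq_integral do rewrite lincombM EFinM EFinB.
rewrite integralZl//; last first.
  by apply: integrableB => //; exact: integrable_lincomb_sqr.
rewrite integralB//; [|exact: integrable_lincomb_sqr..].
rewrite !lincomb_second_moment// -EFinB -EFinM; congr EFin.
by rewrite -sumrB mulr_sumr; apply: eq_bigr => i _ /=; field.
Qed.

End linear_combinations.

(** * Markov chains driven by innovations *)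

Section product_space.
Context (I : Type) d (S : measurableType d) d' (T : measurableType d').

Lemma measurable_coordinate (i : I) :
  measurable_fun setT (fun f : product_space I S => f i).
Proof.
by move=> _ B mB; rewrite setTI; apply: sub_sigma_algebra; exists i, B.
Qed.

Lemma measurable_to_product_space (f : T -> product_space I S) :
  (forall i, measurable_fun setT (fun w => f w i)) -> measurable_fun setT f.
Proof.
move=> mf.
apply: (@measurability _ _ T (product_space I S) setT f (@cylinders I _ S))
  => //.
by move=> _ [_ [i [B [mB ->]]] <-]; exact: mf.
Qed.

End product_space.

Section markov.
Context d (O : measurableType d) (R : realType) (P : probability O R).
Context (ds : nat -> measure_display) (S : forall n, measurableType (ds n)).
Context (dT : nat -> measure_display) (T : forall n, measurableType (dT n)).
Variables (X : forall n, O -> S n) (V : forall n, O -> T n).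
Variables (F : nat -> set (set O)) (phi : forall n, S n * T n -> S n.+1).
Arguments phi : clear implicits.
Hypothesis sF : forall n, sigma_algebra setT (F n).
Hypothesis mF : forall n, F n `<=` measurable.
Hypothesis FX : forall k n, (k <= n)%N ->
  g_sigma_algebra_preimage (X k) `<=` F n.
Hypothesis mV : forall n, measurable_fun setT (V n).
Hypothesis FV : forall n,
  indep_systems P (F n) (g_sigma_algebra_preimage (V n)).
Hypothesis mphi : forall n, measurable_fun setT (phi n).
Hypothesis XS : forall n w, X n.+1 w = phi n (X n w, V n w).

(** The frozen conditional probability is a function of X n, hence a version of
    the conditional probability given X n as well as given the past. *)
Lemma markov_chain_innovation : markov_chain P X.
Proof.
have FI n : setI_closed (F n).
  have := @measurableI _ (g_sigma_algebraType (F n)).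
  by rewrite /measurable/= (sigma_algebra_id (sF n)).
split=> [n _ B mB|n B mB].
  by apply: (mF (n := n)); apply: (FX (leqnn n)); exists B.
have pastF : sigma_past X n `<=` F n.
  by apply: smallest_sub => // A [k /= kn]; exact: FX.
have XA E : measurable E -> g_sigma_algebra_preimage (X n) (X n @^-1` E).
  by move=> mE; exists E => //; rewrite setTI.
have mC : measurable (phi n @^-1` B).
  by rewrite -[X in measurable X]setTI; exact: mphi.
have -> : X n.+1 @^-1` B = (fun w => (X n w, V n w)) @^-1` (phi n @^-1` B).
  by apply/seteqP; split => w /=; rewrite XS.
exists (fun w => fine (P (V n @^-1` xsection (phi n @^-1` B) (X n w)))); split.
  exact: (cond_exp_freezing (FX (leqnn n)) (FI n) (@mF n) XA (@mV n) (@FV n)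
    mC).
apply: (cond_exp_freezing pastF (FI n) (@mF n) _ (@mV n) (@FV n) mC) => E mE.
by apply: sub_sigma_algebra; exists n => /=; [|exact: XA].
Qed.

End markov.

(** * The random field *)

Section weights.
Context (R : realType) dZ (OZ : measurableType dZ) (PZ : probability OZ R)
  (Z : {RV PZ >-> product_space nat bool}).
Variables (alpha : R) (alpha01 : 0 < alpha < 1).

Lemma rho_le1 A : rho Z A <= 1.
Proof.
rewrite /rho unlock.
pose f w : R := \prod_(j <- A) (-1) ^+ Z w j.
have mf : measurable_fun setT f.
  apply: measurable_prod => j _.
  have mb : measurable_fun setT (fun b : bool => (-1) ^+ b : R) by [].
  apply: measurableT_comp mb _.
  have mZ := measurable_funPT Z.
  exact: (measurableT_comp (@measurable_coordinate nat _ bool j) mZ).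
have f1 w : `|f w| = 1.
  by rewrite /f normr_prod big1// => j _; rewrite normrX normrN1 expr1n.
have fle : (`|\int[PZ]_w (f w)%:E| <= 1)%E.
  apply: (le_trans (le_abse_integral PZ measurableT _)).
    exact/measurable_EFinP.
  under eq_integral do rewrite /= f1.
  by rewrite integral_cst//= mul1e probability_le1.
have ffin : (\int[PZ]_w (f w)%:E)%E \is a fin_num.
  by rewrite fin_num_abs (le_lt_trans fle) ?ltry.
rewrite -lee_fin fineK//; exact: le_trans (lee_abs _) fle.
Qed.

Lemma weight_gt0 A : 0 < weight Z alpha A.
Proof.
move: alpha01 => /andP[a0 a1]; rewrite /weight ltr_pwDl// mulr_ge0//.
  by rewrite divr_ge0// ?ltW// subr_gt0.
by rewrite subr_ge0 rho_le1.
Qed.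

(** Hence the term of the empty set follows the same formula as the others. *)
Lemma weight_fset0 : weight Z alpha fset0 = 1.
Proof.
rewrite /weight /rho (_ : (fun _ => _) = cst 1); last first.
  by apply/funext => w; rewrite big_seq_fset0.
by rewrite expectation_cst subrr mulr0 addr0.
Qed.

End weights.

Section truncation.

Lemma nth_trunc N (f : nat -> bool) k :
  (k < N)%N -> nth false (trunc N f) k = f k.
Proof. by move=> kN; rewrite -(tnth_nth _ _ (Ordinal kN)) tnth_mktuple. Qed.

Lemma trunc_last_trunc N (f : nat -> bool) :
  trunc_last (trunc N.+1 f) = trunc N f.
Proof.
apply: eq_from_tnth => i; rewrite !tnth_mktuple nth_trunc//.
by rewrite (leq_trans (ltn_ord i)).
Qed.

Lemma mem_segment N k : (k \in segment N) = (k < N)%N.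
Proof. by rewrite !inE mem_iota. Qed.

Lemma segmentS m n : (m <= n)%N -> (segment m `<=` segment n)%fset.
Proof.
by move=> mn; apply/fsubsetP => k; rewrite !mem_segment => /leq_trans; exact.
Qed.

End truncation.

Section model.
Context (R : realType) dZ (OZ : measurableType dZ) (PZ : probability OZ R)
  (Z : {RV PZ >-> product_space nat bool}).
Variables (alpha : R) (alpha01 : 0 < alpha < 1).
Context d (O : measurableType d) (P : probability O R)
  (g : {fset nat} -> {RV P >-> R}).
Hypothesis g_iid : iid_standard_normal g.

Local Notation gf := (gfield Z g alpha).
Local Notation isqrt2 := (2 `^ (- 2^-1) : R).

Definition coef N (x : nat -> bool) (A : {fset nat}) : R :=
  2 `^ (- (N%:R / 2)) *
  ((Num.sqrt (weight Z alpha A))^-1 * \prod_(k <- A) (-1) ^+ x k).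

(** N codes the last position of [N + 1]. *)
Definition newsets N : seq {fset nat} :=
  [seq A <- fpowerset (segment N.+1) | ([fset N] `<=` A)%fset].

Definition oldfamily N : set {fset nat} := [set A | (A `<=` segment N)%fset].
Definition newfamily N : set {fset nat} := [set A | ([fset N] `<=` A)%fset].

Definition innovation N (x : N.+1.-tuple bool) : O -> R :=
  lincomb g (newsets N) (coef N.+1 (nth false x)).

Lemma uniq_newsets N : uniq (newsets N).
Proof. by rewrite filter_uniq// fset_uniq. Qed.

Lemma coef_sub N (x y : nat -> bool) A :
  (A `<=` segment N)%fset -> (forall k, (k < N)%N -> x k = y k) ->
  coef N x A = coef N y A.
Proof.
move=> AN xy; rewrite /coef; congr (_ * (_ * _)).
rewrite !big_seq; apply: eq_bigr => k kA.
by rewrite xy// -mem_segment; exact: (fsubsetP AN).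
Qed.

Lemma gfield_lincomb N (x : N.-tuple bool) :
  gf x = lincomb g (fpowerset (segment N)) (coef N (nth false x)).
Proof.
apply/funext => w; rewrite /gfield /lincomb.
rewrite [RHS](bigD1_seq fset0) ?fpowersetE ?fsub0set ?fset_uniq//=.
rewrite {1}/coef weight_fset0 sqrtr1 invr1 big_seq_fset0 !mulr1 mulrDr.
by congr (_ + _); rewrite mulr_sumr; apply: eq_bigr => A _; rewrite mulrA.
Qed.

Lemma coefS N x A : coef N.+1 x A = isqrt2 * coef N x A.
Proof.
rewrite /coef mulrA; congr (_ * _).
rewrite -powRD; last by apply/implyP; rewrite pnatr_eq0.
by congr (_ `^ _); rewrite -natr1; field.
Qed.

Lemma fpowerset_segmentS N :
  perm_eq (fpowerset (segment N.+1)) (fpowerset (segment N) ++ newsets N).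
Proof.
apply: uniq_perm; first exact: fset_uniq.
  rewrite cat_uniq fset_uniq uniq_newsets andbT/=; apply/hasPn => A.
  rewrite mem_filter fsub1set => /andP[NA _]; rewrite /= fpowersetE.
  by apply/negP => /fsubsetP/(_ _ NA); rewrite mem_segment ltnn.
move=> A; rewrite mem_cat mem_filter !fpowersetE fsub1set.
have [NA|NA]/= := boolP (N \in A).
  case: (boolP (A `<=` segment N)%fset) => // AN; rewrite orTb.
  exact: fsubset_trans AN (segmentS (leqnSn N)).
rewrite orbF; apply/idP/idP => AN; last first.
  exact: fsubset_trans AN (segmentS (leqnSn N)).
apply/fsubsetP => k kA; have := fsubsetP AN _ kA.
rewrite !mem_segment ltnS leq_eqVlt.
by case/predU1P => // kN; move: NA; rewrite -kN kA.
Qed.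

(** The recursion: sets without the position coded by N reproduce the previous
    level up to the change of normalization. *)
Lemma gfieldS N (x : N.+1.-tuple bool) w :
  gf x w = isqrt2 * gf (trunc_last x) w + innovation x w.
Proof.
rewrite !gfield_lincomb /innovation /lincomb.
rewrite (perm_big _ (fpowerset_segmentS N)) big_cat/=; congr (_ + _).
rewrite mulr_sumr !big_seq; apply: eq_bigr => A.
rewrite fpowersetE => AN; rewrite mulrA; congr (_ * _).
rewrite coefS; congr (_ * _); apply: coef_sub => // k kN.
by rewrite nth_trunc.
Qed.

Local Notation old_sigma N := (sigma_family g (oldfamily N)).

Lemma sigma_algebra_old N : sigma_algebra setT (old_sigma N).
Proof. exact: smallest_sigma_algebra. Qed.

Lemma old_sigma_measurable N : old_sigma N `<=` measurable.
Proof.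
apply: smallest_sub; first exact: sigma_algebra_measurable.
exact: measurable_cylinders.
Qed.

Lemma measurable_gfield_old k N (x : k.-tuple bool) : (k <= N)%N ->
  family_measurable g (oldfamily N) (gf x).
Proof.
move=> kN; rewrite gfield_lincomb; apply: measurable_lincomb_family => A.
rewrite fpowersetE => Ak; exact: fsubset_trans Ak (segmentS kN).
Qed.

Lemma measurable_Gfield_old k N : (k <= N)%N ->
  family_measurable g (oldfamily N) (Gfield Z g alpha k).
Proof.
move=> kN; apply: measurable_to_product_space => y.
exact: measurable_gfield_old.
Qed.

Lemma measurable_innovation_new N (x : N.+1.-tuple bool) :
  family_measurable g (newfamily N) (innovation x).
Proof.
by apply: measurable_lincomb_family => A; rewrite mem_filter => /andP[].
Qed.

Lemma old_new N : oldfamily N `&` newfamily N = set0.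
Proof.
apply/seteqP; split => // A [/= AN NA].
have : N \in segment N by apply: (fsubsetP AN); rewrite -fsub1set.
by rewrite mem_segment ltnn.
Qed.

Lemma preimage_old N d' (T : measurableType d') (f : O -> T) :
  family_measurable g (oldfamily N) f ->
  g_sigma_algebra_preimage f `<=` old_sigma N.
Proof. by move=> mf _ [B mB <-]; exact: mf. Qed.

Lemma indep_innovation N d' (T : measurableType d') (V : O -> T) :
  family_measurable g (newfamily N) V ->
  indep_systems P (old_sigma N) (g_sigma_algebra_preimage V).
Proof. by apply: indep_family_fun; [exact: g_iid.2|exact: old_new]. Qed.

Lemma innovation_covariance N (x y : N.+1.-tuple bool) :
  (\int[P]_w (innovation x w * innovation y w)%:E =
   ((2 ^+ N.+1)^-1 *
     \sum_(A <- fpowerset (segment N.+1) | ([fset N] `<=` A)%fset)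
       (weight Z alpha A)^-1 *
       \prod_(k <- A) (-1) ^+ (nth false x k + nth false y k))%:E)%E.
Proof.
rewrite lincomb_covariance ?uniq_newsets//; congr EFin.
rewrite big_filter mulr_sumr; apply: eq_bigr => A _; rewrite /coef.
under [in RHS]eq_bigr do rewrite exprD.
rewrite big_split/= mulrACA [X in _ * X = _]mulrACA; congr (_ * (_ * _)).
  rewrite -powRD; last by apply/implyP; rewrite pnatr_eq0.
  rewrite (_ : _ + _ = - N.+1%:R); last by field.
  by rewrite powRN powR_mulrn.
by rewrite -invfM -expr2 sqr_sqrtr// ltW// weight_gt0.
Qed.

Lemma cond_exp_gfield N (x : N.+1.-tuple bool) :
  is_cond_exp P (g_sigma_algebra_preimage (Gfield Z g alpha N))
    (gf x) (fun w => isqrt2 * gf (trunc_last x) w).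
Proof.
have mG := measurable_Gfield_old (leqnn N).
have -> : gf x = (fun w => isqrt2 * gf (trunc_last x) w) \+ innovation x.
  by apply/funext => w; rewrite gfieldS.
apply: (cond_exp_add_indep (preimage_old mG)) => //.
- exact: old_sigma_measurable.
- by apply: indep_innovation; exact: measurable_innovation_new.
- exact: (integrable_lincomb g_iid _ (uniq_newsets N)).
- move=> B mB.
  exists [set f : product_space (N.-tuple bool) R |
    B (isqrt2 * f (trunc_last x))]; last by rewrite setTI.
  rewrite -[X in measurable X]setTI.
  apply: (_ : measurable_fun setT (fun f : product_space (N.-tuple bool) R =>
    isqrt2 * f (trunc_last x))) => //.
  by apply: measurable_funM => //; exact: measurable_coordinate.
- rewrite (_ : _ \o _ =
    (fun w => (isqrt2%:E * (gf (trunc_last x) w)%:E)%E)); last first.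
    by apply/funext => w; rewrite /= EFinM.
  apply: integrableZl => //; rewrite gfield_lincomb.
  exact: (integrable_lincomb g_iid _ (fset_uniq _)).
- exact: (lincomb_expectation g_iid _ (uniq_newsets N)).
Qed.

Lemma cond_cov_gfield N (x y : N.+1.-tuple bool) :
  is_cond_cov P (g_sigma_algebra_preimage (Gfield Z g alpha N)) (gf x) (gf y)
    (fun=> (2 ^+ N.+1)^-1 *
       \sum_(A <- fpowerset (segment N.+1) | ([fset N] `<=` A)%fset)
         (weight Z alpha A)^-1 *
         \prod_(k <- A) (-1) ^+ (nth false x k + nth false y k)).
Proof.
have mG := measurable_Gfield_old (leqnn N).
exists (fun w => isqrt2 * gf (trunc_last x) w),
  (fun w => isqrt2 * gf (trunc_last y) w).
split; [exact: cond_exp_gfield|exact: cond_exp_gfield|].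
rewrite (_ : (fun w => _) =
  (fun w => innovation x w * innovation y w)); last first.
  by apply/funext => w; rewrite !gfieldS; ring.
set c := (X in is_cond_exp _ _ _ (fun=> X)).
have -> : c = fine (\int[P]_w (innovation x w * innovation y w)%:E).
  by rewrite innovation_covariance.
apply: (cond_exp_indep (preimage_old mG)).
- exact: old_sigma_measurable.
- apply: indep_innovation; apply: measurable_funM;
    exact: measurable_innovation_new.
- exact: (integrable_lincombM g_iid _ _ (uniq_newsets N)).
- by exists setT => //; rewrite setTI preimage_setT.
- by exists set0 => //; rewrite setTI preimage_set0.
Qed.

(** All levels of a path up to n are linear combinations of the same finite
    family, at the price of zero coefficients. *)
Lemma gfield_lincomb_segment n i (x : nat -> bool) : (i <= n)%N ->
  gf (trunc i x) = lincomb g (fpowerset (segment n))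
    (fun A => if (A `<=` segment i)%fset then coef i x A else 0).
Proof.
move=> lein; rewrite gfield_lincomb; apply/funext => w; rewrite /lincomb.
transitivity (\sum_(A <- fpowerset (segment n) | (A `<=` segment i)%fset)
    coef i x A * g A w); last first.
  rewrite big_mkcond/=; apply: eq_bigr => A _.
  by case: ifP => //; rewrite mul0r.
rewrite -[RHS]big_filter [RHS](perm_big (fpowerset (segment i)))/=; last first.
  apply: uniq_perm; rewrite ?filter_uniq ?fset_uniq// => A.
  rewrite mem_filter !fpowersetE andb_idr// => Ai.
  exact: fsubset_trans Ai (segmentS lein).
rewrite !big_seq; apply: eq_bigr => A; rewrite fpowersetE => Ai; congr (_ * _).
by apply: coef_sub => // k ki; rewrite nth_trunc.
Qed.

Lemma gaussian_sequence_gfield (x : nat -> bool) :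
  gaussian_sequence P (fun N => gf (trunc N x)).
Proof.
move=> n c; pose e (A : {fset nat}) : R :=
  \sum_(i < n) c i * (if (A `<=` segment i)%fset then coef i x A else 0).
rewrite (_ : (fun w => _) = lincomb g (fpowerset (segment n)) e).
  exact: (gaussian_lincomb g_iid _ (fset_uniq _)).
apply/funext => w.
under eq_bigr => i _.
  rewrite (gfield_lincomb_segment x (ltnW (ltn_ord i))) /lincomb mulr_sumr.
  over.
rewrite exchange_big/=; apply: eq_bigr => A _; rewrite /e mulr_suml.
by apply: eq_bigr => i _; rewrite mulrA.
Qed.

Lemma markov_chain_gfield (x : nat -> bool) :
  markov_chain P (fun N => gf (trunc N x)).
Proof.
apply: (@markov_chain_innovation _ _ _ _ _ _ _ _ _
  (fun N => innovation (trunc N.+1 x)) (fun N => old_sigma N)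
  (fun _ (u : R * R) => isqrt2 * u.1 + u.2)) => [n|n|k n kn|n|n|n|n w].
- exact: sigma_algebra_old.
- exact: old_sigma_measurable.
- by apply: preimage_old; exact: measurable_gfield_old.
- exact: measurable_lincomb.
- by apply: indep_innovation; exact: measurable_innovation_new.
- by apply: measurable_funD => //; exact: measurable_funM.
- by rewrite gfieldS trunc_last_trunc.
Qed.

Lemma markov_chain_Gfield : markov_chain P (Gfield Z g alpha).
Proof.
pose S N := product_space (N.-tuple bool) R.
pose V N w : S N.+1 := fun x => innovation x w.
pose phi N (u : S N * S N.+1) : S N.+1 :=
  fun x => isqrt2 * u.1 (trunc_last x) + u.2 x.
apply: (@markov_chain_innovation _ _ _ _ _ S _ (fun N => S N.+1) _ V
  (fun N => old_sigma N) phi) => [n|n|k n kn|n|n|n|n w].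
- exact: sigma_algebra_old.
- exact: old_sigma_measurable.
- by apply: preimage_old; exact: measurable_Gfield_old.
- by apply: measurable_to_product_space => y; exact: measurable_lincomb.
- by apply: indep_innovation; apply: measurable_to_product_space => y;
    exact: measurable_innovation_new.
- apply: measurable_to_product_space => y; apply: measurable_funD.
    apply: measurable_funM => //.
    exact: (measurableT_comp (measurable_coordinate _) measurable_fst).
  exact: (measurableT_comp (measurable_coordinate _) measurable_snd).
- by apply/funext => y; rewrite /Gfield gfieldS.
Qed.

End model.

Theorem proposition3 (R : realType)
    (dZ : measure_display) (OZ : measurableType dZ) (PZ : probability OZ R)
    (Z : {RV PZ >-> product_space nat bool})
    (alpha : R) (alpha01 : 0 < alpha < 1)
    (d : measure_display) (O : measurableType d) (P : probability O R)
    (g : {fset nat} -> {RV P >-> R}) (g_iid : iid_standard_normal g) :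
  [/\ forall x : nat -> bool,
        gaussian_sequence P (fun N => gfield Z g alpha (trunc N x)) /\
        markov_chain P (fun N => gfield Z g alpha (trunc N x)),
      markov_chain P (Gfield Z g alpha),
      forall (N : nat) (x : N.+1.-tuple bool),
        is_cond_exp P (g_sigma_algebra_preimage (Gfield Z g alpha N))
          (gfield Z g alpha x)
          (fun w => 2 `^ (- 2^-1) * gfield Z g alpha (trunc_last x) w) &
      forall (N : nat) (x y : N.+1.-tuple bool),
        is_cond_cov P (g_sigma_algebra_preimage (Gfield Z g alpha N))
          (gfield Z g alpha x) (gfield Z g alpha y)
          (fun=> (2 ^+ N.+1)^-1 *
             \sum_(A <- fpowerset (segment N.+1) | ([fset N] `<=` A)%fset)
               (weight Z alpha A)^-1 *
               \prod_(k <- A) (-1) ^+ (nth false x k + nth false y k))].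
Proof.
split => [x||N x|N x y].
- split; [exact: gaussian_sequence_gfield|exact: markov_chain_gfield].
- exact: markov_chain_Gfield.
- exact: cond_exp_gfield.
- exact: cond_cov_gfield.
Qed.
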